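(* Let $\mathbb{X}$ be a normed space. Let $M_{\delta_{\mathbb{X}}(\epsilon)} \neq \emptyset$ for some $\epsilon \in (0, 2)$. Then there exists $(u_0, v_0) \in M_{\delta_{\mathbb{X}}(\epsilon)}$ such that $u_0 \perp_I^{\epsilon_0} v_0$, where $\epsilon_0 = \left|1+ \delta_{\mathbb{X}}(\epsilon)^2 - 2\delta_{\mathbb{X}}(\epsilon)- \frac{\epsilon^2}{4}\right|\in [0, 1)$.
   Context: Normed spaces are real. $S_{\mathbb{X}} = \{x\in\mathbb{X} : \|x\|=1\}$ is the unit sphere of $\mathbb{X}$. For $\epsilon\in[0,2]$, the modulus of convexity is $\delta_{\mathbb{X}}(\epsilon) = \inf\{1 - \frac{\|x + y\|}{2} : x,y \in S_{\mathbb{X}}, \|x - y \| \geq \epsilon\}$, and its attainment set is $M_{\delta_{\mathbb{X}}(\epsilon)} = \{ (x, y) \in S_{\mathbb{X}} \times S_{\mathbb{X}} : \|x-y\|\ge\epsilon,\ 1- \frac{\|x +y\|}{2} = \delta_{\mathbb{X}}(\epsilon)\}$. For $\eta\in[0,1)$, approximate isosceles orthogonality $x\perp_I^{\eta} y$ means $\left|\|x+y\|^2-\|x-y\|^2\right|\le 4\eta\|x\|\|y\|$.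
   Formalization: The normed space is assumed to have dimension at least 2; on the real line the claim fails for every ε in (0,2), since only antipodal unit pairs are ε-separated, δ = 1, ε_0 = ε²/4, and the orthogonality defect is 4 > 4ε_0. *)

(* Defs.v *)
From mathcomp Require Import all_boot all_order all_algebra.
From mathcomp Require Import all_classical all_reals all_analysis.
Set Implicit Arguments.
Unset Strict Implicit.
Unset Printing Implicit Defensive.
Import Order.TTheory GRing.Theory Num.Theory.
Import numFieldNormedType.Exports.
Local Open Scope classical_set_scope.
Local Open Scope ring_scope.

Section ModulusOfConvexity.
Context {R : realType} (X : normedModType R).

Definition unit_sphere : set X := [set x | `|x| = 1].

(* The real infimum is the genuine one here: the set is bounded below by 0, and
   it is nonempty as soon as X is nontrivial and eps <= 2. *)
Definition convexity_modulus (eps : R) : R :=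
  inf [set t | exists x y : X,
    [/\ unit_sphere x, unit_sphere y, eps <= `|x - y|
      & t = 1 - `|x + y| / 2]].

Definition convexity_attainment (eps : R) : set (X * X) :=
  [set p | [/\ unit_sphere p.1, unit_sphere p.2, eps <= `|p.1 - p.2|
             & 1 - `|p.1 + p.2| / 2 = convexity_modulus eps]].

Definition approx_isosceles_orthogonal (eta : R) (x y : X) : Prop :=
  `| `|x + y| ^+ 2 - `|x - y| ^+ 2 | <= 4 * eta * `|x| * `|y|.

(* The modulus of convexity is meant for spaces of dimension at least 2: on a
   line and for 0 < eps < 2 only antipodal unit pairs are eps-separated, so the
   distance eps is never realised. *)
Definition dim_ge2 : Prop :=
  exists e1 e2 : X,
    forall a b : R, a *: e1 + b *: e2 = 0 -> a = 0 /\ b = 0.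

End ModulusOfConvexity.

Arguments unit_sphere {R} X.
Arguments convexity_modulus {R} X eps.
Arguments convexity_attainment {R} X eps.

(* Main.v *)
(** Among attaining pairs it suffices to find one with [|u - v| = eps], because then
    [ |u + v| = 2 (1 - delta) ] and the orthogonality defect is exactly [4 eps0].
    Start from any attaining [(x, y)], keep [x] and move [y] along the unit sphere
    to [x] inside the plane of [x] and [y].  The distance to [x] takes the value
    [eps] by the intermediate value theorem, while [|x + y|] does not decrease
    (monotonicity of the norm along an arc), so the pair stays attaining.  If
    [y = - x] the segment joining them passes through 0, but then [|x + y| = 0] and any
    path on the sphere from [x] to [- x] will do; this uses dimension at least 2. *)
Require Import Defs.
From mathcomp Require Import all_boot all_order all_algebra.
From mathcomp Require Import all_classical all_reals all_analysis.
From mathcomp Require Import ring lra.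
Import Order.TTheory GRing.Theory Num.Theory.
Import numFieldNormedType.Exports.
Local Open Scope classical_set_scope.
Local Open Scope ring_scope.

(** For [a > 0], a positive multiple of [x + y] is a nonnegative combination of [z] with [x + z] (if
    [b <= a]) or with [y] (if [a < b]). The triangle inequality and the bound [lower] then
    conclude. *)
Lemma norm_add_arc_mono (R : realType) (X : normedModType R) (x y z : X) (a b : R) :
  `|x| = 1 -> `|y| = 1 -> `|z| = 1 -> 0 <= a -> 0 <= b ->
  z = a *: y + b *: x -> `|x + y| <= `|x + z|.
Proof.
move=> x1 y1 z1 a0 b0 zE.
(* If [a = 0] then [z = x], and [x + z] has norm 2, the largest possible value. *)
have [a_eq0|a_neq0] := eqVneq a 0.
  have b1 : b = 1 by move: z1; rewrite zE a_eq0 scale0r add0r normrZ x1 mulr1 ger0_norm.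
  rewrite zE a_eq0 b1 scale0r add0r scale1r -mulr2n normrMn x1.
  by rewrite (le_trans (ler_normD _ _)) // x1 y1.
have a_gt0 : 0 < a by rewrite lt_neqAle eq_sym a_neq0.
have ayE : a *: y = z - b *: x by rewrite zE addrK.
(* Both cases below leave the remainder [1 + b - a]; the reverse triangle inequality for
   [b *: (x + z)] absorbs it. *)
have lower : 1 + b - a <= b * `|x + z|.
  have -> : b * `|x + z| = `|(1 + b) *: z - a *: y|.
    rewrite -[X in X * _](ger0_norm b0) -normrZ ayE; congr (`|_|).
    by rewrite scalerDl scale1r scalerDr opprB [RHS]addrC addrA subrK.
  have := lerB_dist ((1 + b) *: z) (a *: y).
  by rewrite !normrZ y1 z1 !mulr1 !ger0_norm // addr_ge0.
have axyE : a *: (x + y) = z + (a - b) *: x.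
  by rewrite scalerDr ayE scalerBl addrCA.
rewrite -(ler_pM2l a_gt0) -[X in X * _ <= _](ger0_norm a0) -normrZ axyE.
have [ba|ab] := leP b a.
- have ab1 : a - b <= 1.
    have := lerB_dist (a *: y) (- (b *: x)).
    by rewrite opprK -zE normrN !normrZ x1 y1 z1 !mulr1 !ger0_norm.
  have -> : z + (a - b) *: x = (a - b) *: (x + z) + (1 - (a - b)) *: z.
    move: (a - b) => c.
    by rewrite scalerDr scalerBl scale1r -addrA [X in _ = _ + X]addrC subrK addrC.
  apply: le_trans (ler_normD _ _) _.
  rewrite !normrZ z1 !ger0_norm ?subr_ge0 //; lra.
- have b_gt0 : 0 < b by exact: le_lt_trans ab.
  rewrite -(ler_pM2l b_gt0) -[X in X * _ <= _](ger0_norm b0) -normrZ.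
  have -> : b *: (z + (a - b) *: x) = (b - a) *: (a *: y) + a *: z.
    rewrite ayE scalerBr scalerDr !scalerA scalerBl addrAC subrK.
    by congr (_ + _); rewrite -scaleNr; congr (_ *: _); ring.
  apply: le_trans (ler_normD _ _) _.
  rewrite !normrZ y1 z1 !ger0_norm ?subr_ge0 ?(ltW ab) //.
  have := ler_wpM2l a0 lower; lra.
Qed.

Lemma norm_normalized (R : realType) (X : normedModType R) (w : X) :
  w != 0 -> `| `|w|^-1 *: w| = 1.
Proof.
by move=> w0; rewrite normrZ ger0_norm ?invr_ge0 // mulVf // normr_eq0.
Qed.

(** Radial projection puts the path on the sphere without moving its endpoints, so the distance to
    [w 0] varies continuously from 0. *)
Lemma sphere_path_IVT (R : realType) (X : normedModType R) (w : R -> X) (eps : R) :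
  continuous w -> {in `[0, 1], forall t, w t != 0} ->
  `|w 0| = 1 -> `|w 1| = 1 -> 0 <= eps <= `|w 0 - w 1| ->
  exists2 t, t \in `[0, 1] & `|w 0 - `|w t|^-1 *: w t| = eps.
Proof.
move=> cw w_neq0 w0 w1 heps.
pose f t := `|w 0 - `|w t|^-1 *: w t|.
have cf : {within `[0, 1], continuous f}.
  apply: continuous_in_subspaceT => t /set_mem t01.
  have cwt : `|w u| @[u --> t] --> `|w t| by apply: cvg_norm; exact: cw.
  apply: cvg_norm; apply: cvgB; first exact: cvg_cst.
  by apply: cvgZ; [apply: cvgV => //; rewrite normr_eq0 w_neq0 | exact: cw].
have f0 : f 0 = 0 by rewrite /f w0 invr1 scale1r subrr normr0.
have f1 : f 1 = `|w 0 - w 1| by rewrite /f w1 invr1 scale1r.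
apply: (IVT ler01 cf).
by rewrite f0 f1 min_l ?max_r.
Qed.

(** Supplies a direction in which a path from [x] to [- x] can bypass 0: [e1], or [e2] when [x] lies
    on the line of [e1]. *)
Lemma dim_ge2_line_avoid (R : realType) (X : normedModType R) (x : X) :
  dim_ge2 X -> x != 0 ->
  exists2 z : X, z != 0 & forall c, x != c *: z.
Proof.
move=> [e1 [e2 indep]] x0.
have [[a xa]|nex] := pselect (exists a, x = a *: e1); last first.
  exists e1.
    apply/eqP => e10; have [|] := indep 1 0; last by move/eqP; rewrite oner_eq0.
    by rewrite e10 scaler0 scale0r addr0.
  by move=> c; apply/eqP => xc; apply: nex; exists c.
exists e2.
  apply/eqP => e20; have [|_] := indep 0 1; last by move/eqP; rewrite oner_eq0.
  by rewrite e20 scaler0 scale0r addr0.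
move=> b; apply/eqP => xb.
have [|a0 _] := indep a (- b); first by rewrite scaleNr -xa -xb subrr.
by move: x0; rewrite xa a0 scale0r eqxx.
Qed.

Lemma exists_dist_eq_norm_add_ge (R : realType) (X : normedModType R) (x y : X)
    (eps : R) :
  dim_ge2 X -> `|x| = 1 -> `|y| = 1 -> 0 <= eps <= `|x - y| ->
  exists z : X, [/\ `|z| = 1, `|x - z| = eps & `|x + y| <= `|x + z|].
Proof.
move=> hX x1 y1 heps.
have x0 : x != 0 by rewrite -normr_eq0 x1 oner_eq0.
have [yNx|yNx] := eqVneq y (- x).
- have [e e0 xe] := dim_ge2_line_avoid _ _ _ hX x0.
  (* The [e] term bends the segment from [x] to [- x] away from 0: its coefficient is 1/4 at
     [t = 1/2], the only place where the [x] term vanishes. *)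
  pose w (t : R) := (1 - 2 * t) *: x + (t * (1 - t)) *: e.
  have w0 : w 0 = x by rewrite /w mulr0 mul0r subr0 scale1r scale0r addr0.
  have w1 : w 1 = y.
    rewrite /w subrr mulr0 scale0r addr0 yNx -[RHS]scaleN1r; congr (_ *: _); ring.
  have cw : continuous w.
    move=> t; apply: cvgD; apply: cvgZr_tmp.
      by apply: cvgB; [exact: cvg_cst|apply: cvgMl_tmp; exact: cvg_id].
    by apply: cvgM; [exact: cvg_id|apply: cvgB; [exact: cvg_cst|exact: cvg_id]].
  have w_neq0 : {in `[0, 1], forall t, w t != 0}.
    move=> t _; apply/eqP; rewrite /w => wt0.
    have [t2|t2] := eqVneq (1 - 2 * t) 0.
      move: wt0; rewrite t2 scale0r add0r => /eqP; rewrite scaler_eq0 (negbTE e0).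
      rewrite orbF => /eqP; have -> : t = 2^-1 by lra.
      lra.
    move/eqP: wt0; rewrite addr_eq0 => /eqP wt0.
    move/eqP: (xe (- ((1 - 2 * t)^-1 * (t * (1 - t))))); apply.
    by rewrite scaleNr -scalerA -scalerN -wt0 scalerA mulVf // scale1r.
  have [|||t t01 wt] := sphere_path_IVT _ _ w eps cw w_neq0; rewrite ?w0 ?w1 //.
  exists (`|w t|^-1 *: w t); split => //; first by rewrite norm_normalized ?w_neq0.
    by rewrite -{1}w0.
  by rewrite yNx subrr normr0.
pose w (t : R) := (1 - t) *: x + t *: y.
have w0 : w 0 = x by rewrite /w subr0 scale1r scale0r addr0.
have w1 : w 1 = y by rewrite /w subrr scale0r add0r scale1r.
have cw : continuous w.
  move=> t; apply: cvgD; apply: cvgZr_tmp; last exact: cvg_id.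
  by apply: cvgB; [exact: cvg_cst|exact: cvg_id].
have w_neq0 : {in `[0, 1], forall t, w t != 0}.
  (* At a zero the two terms have equal norms, so [1 - t = t] and [y = - x]. *)
  move=> t; rewrite in_itv /= => /andP[t0 t1]; apply: contra yNx.
  rewrite /w addr_eq0 => /eqP wt0.
  have : `|(1 - t) *: x| = `|t *: y| by rewrite wt0 normrN.
  rewrite !normrZ x1 y1 !mulr1 !ger0_norm ?subr_ge0 // => tE.
  have t_neq0 : t != 0 by apply/eqP; lra.
  move: wt0; rewrite tE -scalerN => /(scalerI t_neq0) ->.
  by rewrite opprK.
have [|||t t01 wt] := sphere_path_IVT _ _ w eps cw w_neq0; rewrite ?w0 ?w1 //.
have wt_unit := norm_normalized _ _ _ (w_neq0 t t01).
exists (`|w t|^-1 *: w t); split => //; first by rewrite -{1}w0.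
move: t01; rewrite in_itv /= => /andP[t0 t1].
apply: (norm_add_arc_mono _ _ _ _ _ (`|w t|^-1 * t) (`|w t|^-1 * (1 - t))) => //.
- by rewrite mulr_ge0 // invr_ge0.
- by rewrite mulr_ge0 ?invr_ge0 ?subr_ge0.
- by rewrite -!scalerA -scalerDr addrC.
Qed.

Lemma convexity_modulus_le (R : realType) (X : normedModType R) (eps : R) (x y : X) :
  `|x| = 1 -> `|y| = 1 -> eps <= `|x - y| ->
  convexity_modulus X eps <= 1 - `|x + y| / 2.
Proof.
move=> x1 y1 xy; apply: ge_inf; last by exists x, y.
exists 0 => _ [u [v [u1 v1 _ ->]]].
have := ler_normD u v; rewrite u1 v1; lra.
Qed.

Lemma convexity_attainment_dist_eq (R : realType) (X : normedModType R) (eps : R) :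
  dim_ge2 X -> 0 <= eps -> convexity_attainment X eps !=set0 ->
  exists u v : X, convexity_attainment X eps (u, v) /\ `|u - v| = eps.
Proof.
move=> hX eps0 [[x y] [/= x1 y1 xy xyE]].
have [|z [z1 xz xyz]] := exists_dist_eq_norm_add_ge _ _ x y eps hX x1 y1.
  by rewrite eps0.
exists x, z; split=> //; split=> //=; first by rewrite xz.
(* The value at [(x, z)] is at least the infimum by definition, and at most the attained value at
   [(x, y)] by [xyz]. *)
have := convexity_modulus_le _ _ eps x z x1 z1; rewrite xz lexx => /(_ isT).
lra.
Qed.

Theorem theorem2p17 (R : realType) (X : normedModType R) (hX : dim_ge2 X)
  (eps : R) (heps : 0 < eps < 2) (hM : convexity_attainment X eps !=set0) :
  let delta := convexity_modulus X eps in
  let eps0 := `|1 + delta ^+ 2 - 2 * delta - eps ^+ 2 / 4| in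
  0 <= eps0 < 1 /\
  exists u0 v0 : X, convexity_attainment X eps (u0, v0) /\
    approx_isosceles_orthogonal eps0 u0 v0.
Proof.
move=> delta eps0; have /andP[eps_gt0 eps_lt2] := heps.
have [u [v [uvM uv]]] := convexity_attainment_dist_eq _ _ _ hX (ltW eps_gt0) hM.
have [/= u1 v1 _ uvE] := uvM; rewrite -/delta in uvE.
(* Completing the square: [1 + delta ^+ 2 - 2 * delta] is [(1 - delta) ^+ 2], a quarter of the
   squared norm of [u + v]. *)
have eps0E : eps0 = `| `|u + v| ^+ 2 - `|u - v| ^+ 2| / 4.
  rewrite /eps0 -uvE uv -[X in _ = _ * X]ger0_norm ?invr_ge0 // -normrM.
  by congr (`|_|); field.
split; last first.
  exists u, v; split=> //; rewrite /approx_isosceles_orthogonal u1 v1 !mulr1 eps0E.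
  by rewrite mulrC divfK.
rewrite normr_ge0 /= eps0E uv.
have uv_le2 : `|u + v| <= 2 by have := ler_normD u v; rewrite u1 v1; lra.
have uv_ge0 := normr_ge0 (u + v).
(* Strictness comes from [eps < 2] for the lower bound and from [eps > 0] for the upper one. *)
rewrite ltr_pdivrMr // mul1r ltr_norml; apply/andP; split; nra.
Qed.
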